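(* Assume the eigenvalues of $H$ satisfy $\lambda_i \eqsim i^{-a}$ for some $a>1$. Let $B^{\mathrm{crit}}_{\mathrm{HB}}$ and $B^{\mathrm{crit}}_{\mathrm{ASGD}}$ denote the smallest batch sizes at which the HB lower bound and the ASGD lower bound (both given in the context), respectively, reach the optimal accelerated spectral gap $\Theta(d^{-a/2})$. Then $$B^{\mathrm{crit}}_{\mathrm{HB}} \eqsim d^{a/2},\qquad B^{\mathrm{crit}}_{\mathrm{ASGD}} \eqsim d^{1/2}.$$ Hence $$\frac{B^{\mathrm{crit}}_{\mathrm{HB}}}{B^{\mathrm{crit}}_{\mathrm{ASGD}}} \eqsim d^{(a-1)/2},$$ so for every $a>1$, the ASGD lower bound reaches the accelerated scale at a strictly smaller batch size than the HB lower bound. Equivalently, throughout the interval $$d^{1/2} \lesssim B \lesssim d^{a/2},$$ the ASGD lower bound has already saturated at the accelerated scale.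
   Context: Notation: $f\lesssim g$ means $f\le c\,g$ for some constant $c>0$, and $f\eqsim g$ means $g\lesssim f\lesssim g$. Setting: online noiseless linear regression in $\mathbb{R}^d$ with covariates $x\sim\mathcal N(0,H)$ and labels $y=\langle w^*,x\rangle$. Here $H\succ0$ has eigenvalues $\lambda_1\ge\dots\ge\lambda_d>0$ and $\Lambda=\mathrm{diag}(\lambda_1,\dots,\lambda_d)$. Each step uses a fresh mini-batch of size $B$ with mini-batch gradient $g_t$. Accelerated SGD (ASGD), with parameters $\eta>0$, $0<\beta<1$, $\zeta>0$, is $$\mu_t=\beta\mu_{t-1}+(1-\beta)g_t,\qquad w_{t+1}=w_t-\eta(\mu_t+\zeta g_t).$$ Heavy ball (HB) is the same update with $\zeta=0$, and parameters $\eta>0$, $\beta\in[0,1)$. For each method, the second-moment matrix $S_t$ of an augmented state, expressed in the eigenbasis of $H$, is modelled (up to constant factors in the Gaussian fourth-moment term) by a linear recursion $S_{t+1}=\mathcal T(S_t)$ on symmetric $2d\times2d$ matrices. The augmented state is $(w_t-w^*,\,w_{t-1}-w^* )$ for HB and $(w_t-w^*,\,w_t-w^*+\eta\mu_{t-1})$ for ASGD. Write $S^{11}$ for the upper-left $d\times d$ block of $S$. For HB, $$\mathcal T(S)=ASA^\top+\frac{\eta^2(1-\beta)^2}{B}\begin{bmatrix}\mathrm{Tr}(\Lambda S^{11})\Lambda&0\\0&0\end{bmatrix},$$ where $A$ is block diagonal over coordinates with blocks $$A_i=\begin{bmatrix}(1+\beta)-\eta(1-\beta)\lambda_i&-\beta\\1&0\end{bmatrix}.$$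 For ASGD, $$\mathcal T(S)=ASA^\top+\frac{\eta^2}{B}\,\mathrm{Tr}(\Lambda S^{11})\begin{bmatrix}(\zeta+1-\beta)^2\Lambda&\zeta(\zeta+1-\beta)\Lambda\\\zeta(\zeta+1-\beta)\Lambda&\zeta^2\Lambda\end{bmatrix},$$ with blocks $$A_i=\begin{bmatrix}(1+\beta)-\eta(\zeta+1-\beta)\lambda_i&-\beta\\1-\eta\zeta\lambda_i&0\end{bmatrix}.$$ For each method, $s^*(H,B)$ is the infimum of the spectral radius of $\mathcal T$ over the method's parameters, and $1-s^*(H,B)$ is the optimal spectral gap. Under the power-law assumption $\lambda_i\eqsim i^{-a}$, $a>1$, the ''HB lower bound'' is $$s^*(H,B)\gtrsim 1-\min\{B\,d^{-a},\ d^{-a/2}\},$$ and the ''ASGD lower bound'' is $$s^*(H,B)\gtrsim 1-\begin{cases}B\,d^{-\frac{a^2}{2a-1}},&B\lesssim1,\\ B^{\frac{a}{2a-1}}\,d^{-\frac{a^2}{2a-1}},&1\lesssim B\lesssim d^{1/2},\\ d^{-a/2},&B\gtrsim d^{1/2}.\end{cases}$$ In both bounds $\gtrsim$ absorbs universal constants; that is, the quantity subtracted from $1$ is an upper bound, up to constants, on the optimal spectral gap $1-s^*(H,B)$. A bound ''reaches the accelerated scale'' when this subtracted quantity is of order $d^{-a/2}$. *)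

(* Defs.v *)
From HB Require Import structures.
From mathcomp Require Import all_boot all_order all_algebra.
From mathcomp Require Import complex.
From mathcomp Require Import all_classical all_reals all_analysis.

Set Implicit Arguments.
Unset Strict Implicit.
Unset Printing Implicit Defensive.

Import Order.TTheory GRing.Theory Num.Theory.

Local Open Scope classical_set_scope.
Local Open Scope ring_scope.

(* Two-sided comparison up to constants; D is the range over which the
   constants are uniform. *)
Definition eqsim (R : realType) (X : Type) (D : set X) (f g : X -> R) : Prop :=
  exists k K : R,
    [/\ 0 < k, 0 < K & forall x, D x -> k * g x <= f x <= K * g x].

(* l lists the eigenvalues of the positive definite matrix H with
   multiplicity; the index i : 'I_d stands for i + 1 in 1..d. *)
Definition pd_spectrum (R : realType) (d : nat) (H : 'M[R]_d) (l : 'I_d -> R)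
  : Prop :=
  [/\ H^T = H, char_poly H = \prod_(i < d) ('X - (l i)%:P),
      forall i j : 'I_d, (i <= j)%N -> l j <= l i
    & forall i, 0 < l i].

(* One covariance spectrum per dimension, with constants independent of d. *)
Definition power_law (R : realType) (a : R) (lam : forall d, 'I_d -> R)
  : Prop :=
  exists k K : R, [/\ 0 < k, 0 < K & forall d (i : 'I_d),
    k * (i.+1%:R `^ (- a)) <= lam d i <= K * (i.+1%:R `^ (- a))].

Definition second_moment_op (F : comNzRingType) (d : nat)
    (A : 'M[F]_(d + d)) (L : 'M[F]_d) (N : 'M[F]_(d + d))
    (S : 'M[F]_(d + d)) : 'M[F]_(d + d) :=
  A *m S *m A^T + \tr (L *m ulsubmx S) *: N.

(* Spectral radius of S |-> A S A^T + Tr(L S11) N on real symmetric matrices: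
   the largest modulus of an eigenvalue of its complexification, which acts on
   complex matrices S with S^T = S (plain, not conjugate, transpose). *)
Definition sym_spectral_radius (R : realType) (d : nat)
    (A : 'M[R]_(d + d)) (L : 'M[R]_d) (N : 'M[R]_(d + d)) : R :=
  let toC n (M : 'M[R]_n) : 'M[R[i]]_n := map_mx (real_complex R) M in
  sup [set r : R | exists (z : R[i]) (S : 'M[R[i]]_(d + d)),
    [/\ S^T = S, S != 0,
        second_moment_op (toC _ A) (toC _ L) (toC _ N) S = z *: S
      & r = ComplexField.Normc.normc z]].

Definition diagf (R : realType) (d : nat) (f : 'I_d -> R) : 'M[R]_d :=
  diag_mx (\row_i f i).

(* The 2d coordinates are grouped as (first components, second components), so
   the direct sum of the 2 x 2 matrices A_i is a 2 x 2 array of diagonal d x d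
   blocks. *)
Definition hb_A (R : realType) (d : nat) (l : 'I_d -> R) (eta beta : R)
  : 'M[R]_(d + d) :=
  block_mx (diagf (fun i => (1 + beta) - eta * (1 - beta) * l i))
           ((- beta)%:M)
           1%:M
           0.

Definition hb_noise (R : realType) (d B : nat) (l : 'I_d -> R) (eta beta : R)
  : 'M[R]_(d + d) :=
  (eta ^+ 2 * (1 - beta) ^+ 2 / B%:R) *: block_mx (diagf l) 0 0 0.

Definition hb_radius (R : realType) (d B : nat) (l : 'I_d -> R) (eta beta : R)
  : R :=
  sym_spectral_radius (hb_A l eta beta) (diagf l) (hb_noise B l eta beta).

Definition hb_sstar (R : realType) (d B : nat) (l : 'I_d -> R) : R :=
  inf [set r : R | exists eta beta : R,
    [/\ 0 < eta, 0 <= beta < 1 & r = hb_radius B l eta beta]].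

Definition asgd_A (R : realType) (d : nat) (l : 'I_d -> R) (eta beta zeta : R)
  : 'M[R]_(d + d) :=
  block_mx (diagf (fun i => (1 + beta) - eta * (zeta + 1 - beta) * l i))
           ((- beta)%:M)
           (diagf (fun i => 1 - eta * zeta * l i))
           0.

Definition asgd_noise (R : realType) (d B : nat) (l : 'I_d -> R)
    (eta beta zeta : R) : 'M[R]_(d + d) :=
  (eta ^+ 2 / B%:R) *:
    block_mx ((zeta + 1 - beta) ^+ 2 *: diagf l)
             ((zeta * (zeta + 1 - beta)) *: diagf l)
             ((zeta * (zeta + 1 - beta)) *: diagf l)
             (zeta ^+ 2 *: diagf l).

Definition asgd_radius (R : realType) (d B : nat) (l : 'I_d -> R)
    (eta beta zeta : R) : R :=
  sym_spectral_radius (asgd_A l eta beta zeta) (diagf l)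
    (asgd_noise B l eta beta zeta).

Definition asgd_sstar (R : realType) (d B : nat) (l : 'I_d -> R) : R :=
  inf [set r : R | exists eta beta zeta : R,
    [/\ 0 < eta, 0 < beta < 1, 0 < zeta
      & r = asgd_radius B l eta beta zeta]].

(* The quantities subtracted from 1 in the lower bounds on s*.  K is the
   universal constant hidden in the bound; k1 and k2 are the constants hidden
   in the regime boundaries B ~ 1 and B ~ d^(1/2). *)
Definition hb_gap_bound (R : realType) (a K : R) (d B : nat) : R :=
  K * Num.min (B%:R * d%:R `^ (- a)) (d%:R `^ (- (a / 2))).

Definition asgd_gap_bound (R : realType) (a k1 k2 K : R) (d B : nat) : R :=
  K * (if B%:R <= k1 then
         B%:R * d%:R `^ (- (a ^+ 2 / (2 * a - 1)))
       else if B%:R <= k2 * d%:R `^ (1 / 2) then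
         B%:R `^ (a / (2 * a - 1)) * d%:R `^ (- (a ^+ 2 / (2 * a - 1)))
       else d%:R `^ (- (a / 2))).

(* The lower bound s*(H_d, B) >= 1 - q d B, uniformly in d and B. *)
Definition is_gap_upper_bound (R : realType)
    (sstar : forall d B : nat, ('I_d -> R) -> R) (lam : forall d, 'I_d -> R)
    (q : nat -> nat -> R) : Prop :=
  forall d B : nat, (0 < d)%N -> (0 < B)%N ->
    1 - sstar d B (lam d) <= q d B.

(* "q d B is of order d^(-a/2)", with implied constants c and C. *)
Definition reaches_accelerated (R : realType) (a c C : R)
    (q : nat -> nat -> R) (d B : nat) : Prop :=
  c * d%:R `^ (- (a / 2)) <= q d B <= C * d%:R `^ (- (a / 2)).

Definition is_critical_batch (R : realType) (a c C : R)
    (q : nat -> nat -> R) (d Bc : nat) : Prop :=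
  [/\ (0 < Bc)%N, reaches_accelerated a c C q d Bc
    & forall B, (0 < B)%N -> reaches_accelerated a c C q d B -> (Bc <= B)%N].

(* d^(1/2) <~ B <~ d^(a/2), with implied constants k and k'. *)
Definition batch_window (R : realType) (a k k' : R) (d B : nat) : Prop :=
  [/\ (0 < d)%N, (0 < B)%N
    & k * d%:R `^ (1 / 2) <= B%:R <= k' * d%:R `^ (a / 2)].

(* Main.v *)
(* Write s = d^(1/2) and p = a/(2a-1), so that 0 < p < 1 and
   d^(-a^2/(2a-1)) = d^(-a/2) s^(-p).  After division by K d^(-a/2), the ASGD
   bound becomes B/s^p, (B/s)^p or 1 according to the regime, and the HB bound
   becomes min(B d^(-a/2), 1).  The latter is bounded below only when
   B >~ d^(a/2).  The former is bounded below only when B >~ s: in the first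
   regime B <= k1 this uses B <= k1^(1-p) B^p. *)
Require Import Defs.
From HB Require Import structures.
From mathcomp Require Import all_boot all_order all_algebra.
From mathcomp Require Import complex.
From mathcomp Require Import lra ring.
From mathcomp Require Import all_classical all_reals all_analysis.

Import Order.TTheory GRing.Theory Num.Theory.

Local Open Scope classical_set_scope.
Local Open Scope ring_scope.

(** * Comparison up to constants, real powers, and minimal batch sizes *)

Section Comparison.
Context {R : realType}.

Lemma eqsim_div (X : Type) (D : set X) (f1 f2 g1 g2 : X -> R) :
  (forall x, D x -> 0 < g1 x) -> (forall x, D x -> 0 < g2 x) ->
  eqsim D f1 g1 -> eqsim D f2 g2 ->
  eqsim D (fun x => f1 x / f2 x) (fun x => g1 x / g2 x).
Proof.
move=> g1_gt0 g2_gt0 [m1 [M1 [m1_gt0 M1_gt0 f1P]]].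
move=> [m2 [M2 [m2_gt0 M2_gt0 f2P]]].
exists (m1 / M2), (M1 / m2); split; [exact: divr_gt0|exact: divr_gt0|].
move=> x Dx; have /andP[lb1 ub1] := f1P x Dx; have /andP[lb2 ub2] := f2P x Dx.
have g1x := g1_gt0 x Dx; have g2x := g2_gt0 x Dx.
have f2x : 0 < f2 x by apply: lt_le_trans lb2; rewrite mulr_gt0.
have f1x : 0 < f1 x by apply: lt_le_trans lb1; rewrite mulr_gt0.
rewrite !mulf_div; apply/andP; split.
- apply: ler_pM => //; first by rewrite mulr_ge0 ?ltW.
  + by rewrite invr_ge0 mulr_ge0 ?ltW.
  + by rewrite lef_pV2 ?posrE ?mulr_gt0.
- apply: ler_pM => //; first exact: ltW.
  + by rewrite invr_ge0 ltW.
  + by rewrite lef_pV2 ?posrE ?mulr_gt0.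
Qed.

Lemma eq_eqsimr (X : Type) (D : set X) (f g h : X -> R) :
  (forall x, D x -> g x = h x) -> eqsim D f g -> eqsim D f h.
Proof.
move=> gh [m [M [m_gt0 M_gt0 fP]]]; exists m, M; split => // x Dx.
by rewrite -gh //; exact: fP.
Qed.

Lemma powR_div (x y r : R) : 0 <= x -> 0 <= y ->
  (x / y) `^ r = x `^ r / y `^ r.
Proof.
move=> x_ge0 y_ge0; rewrite powRM ?invr_ge0// -(powR_inv1 y_ge0) -powRrM.
by rewrite mulN1r powRN.
Qed.

Lemma powR_natr_ge1 (d : nat) (r : R) :
  (0 < d)%N -> 0 <= r -> 1 <= (d%:R : R) `^ r.
Proof.
by move=> d_gt0 r_ge0; rewrite -[leLHS](powRr0 d%:R) ler_powR // ler1n.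
Qed.

Lemma powR_natr_gt0 (d : nat) (r : R) : (0 < d)%N -> 0 < (d%:R : R) `^ r.
Proof. by move=> d_gt0; rewrite powR_gt0 // ltr0n. Qed.

Lemma near_infty_ltr_powR (r A : R) : 0 < r ->
  \forall d \near \oo, A < (d%:R : R) `^ r.
Proof.
move=> r_gt0; near=> d.
(* The absolute value covers negative [A]: the [r]-th power of this threshold is [|A|], which is at
   least [A]. *)
have : (`|A| `^ r^-1) < (d%:R : R) by near: d; exact: nbhs_infty_gtr.
move=> /(gt0_ltr_powR r_gt0); rewrite !nnegrE powR_ge0 ler0n => /(_ isT isT).
rewrite -powRrM mulVf ?gt_eqF// powRr1 ?normr_ge0//.
exact: le_lt_trans (ler_norm A).
Unshelve. all: by end_near. Qed.

(** By well-ordering, a single batch size that reaches the scale yields a least one, which inherits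
    the bound [u d]. This reduces the upper estimates of critical batches to exhibiting a saturated
    batch. *)
Lemma exists_critical_batch (a c C : R) (q : nat -> nat -> R) (u : nat -> R) :
  (forall d, (0 < d)%N -> exists B : nat,
     [/\ (0 < B)%N, reaches_accelerated a c C q d B & B%:R <= u d]) ->
  exists Bc : nat -> nat, forall d, (0 < d)%N ->
    is_critical_batch a c C q d (Bc d) /\ (Bc d)%:R <= u d.
Proof.
move=> qP.
suff /choice[Bc BcP] : forall d, exists Bc, (0 < d)%N ->
    is_critical_batch a c C q d Bc /\ Bc%:R <= u d by exists Bc.
(* Dimension 0 is outside the range of the claim; its value 0 is a placeholder. *)
move=> [|d]; first by exists 0%N.
have [B [B_gt0 rB uB]] := qP d.+1 isT.
pose P n := (0 < n)%N && (c * d.+1%:R `^ (- (a / 2)) <= q d.+1 n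
                            <= C * d.+1%:R `^ (- (a / 2))).
have exP : exists n, P n by exists B; rewrite /P B_gt0; exact: rB.
have [Bc /andP[Bc_gt0 rBc] minBc] := ex_minnP exP.
exists Bc => _; split; last first.
  by apply: le_trans uB; rewrite ler_nat minBc// /P B_gt0; exact: rB.
by split=> // n n_gt0 rn; apply: minBc; rewrite /P n_gt0; exact: rn.
Qed.

End Comparison.

(** * The heavy-ball bound, normalised by the accelerated scale *)

Section HeavyBall.
Context {R : realType} {a K : R}.
Hypothesis K_gt0 : 0 < K.

Lemma hb_gap_boundE d B : (0 < d)%N ->
  hb_gap_bound a K d B =
  K * Num.min (B%:R / d%:R `^ (a / 2)) 1 * d%:R `^ (- (a / 2)).
Proof.
move=> d_gt0; rewrite /hb_gap_bound -mulrA minr_pMl ?powR_ge0// mul1r.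
rewrite -mulrA -powRN -powRD; last by rewrite pnatr_eq0 -lt0n d_gt0 implybT.
by rewrite -opprD -splitr.
Qed.

(** The normalised minimum is at most its first argument [B / d^(a/2)], so a lower bound on it is
    one on [B]. *)
Lemma hb_batch_ge (c : R) d B : (0 < d)%N ->
  c * d%:R `^ (- (a / 2)) <= hb_gap_bound a K d B ->
  c / K * d%:R `^ (a / 2) <= B%:R.
Proof.
move=> d_gt0; rewrite hb_gap_boundE// ler_pM2r ?powR_natr_gt0// => cK.
rewrite -ler_pdivlMr ?powR_natr_gt0// ler_pdivrMr// mulrC.
by apply: le_trans cK _; rewrite ler_pM2l// ge_min lexx.
Qed.

Lemma hb_saturated d B : (0 < d)%N -> d%:R `^ (a / 2) <= B%:R ->
  hb_gap_bound a K d B = K * d%:R `^ (- (a / 2)).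
Proof.
move=> d_gt0 dB; rewrite hb_gap_boundE// min_r ?mulr1//.
by rewrite ler_pdivlMr ?mul1r// powR_natr_gt0.
Qed.

End HeavyBall.

(** * The three-regime ASGD bound, normalised by the accelerated scale *)

Section ASGD.
Context {R : realType} {a k1 k2 K : R}.
Hypotheses (a_gt1 : 1 < a) (k1_gt0 : 0 < k1) (k2_gt0 : 0 < k2) (K_gt0 : 0 < K).

Let p := a / (2 * a - 1).

Let den_gt0 : 0 < 2 * a - 1.
Proof. by move: a_gt1; lra. Qed.

Let p_gt0 : 0 < p.
Proof. by rewrite divr_gt0//; move: a_gt1; lra. Qed.

Let p_lt1 : p < 1.
Proof. by rewrite ltr_pdivrMr//; move: a_gt1; lra. Qed.

(** The ASGD bound divided by [K * d^(-a/2)], with real variables [s] for [d^(1/2)] and [b] for the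
    batch size. *)
Let asgd_factor (s b : R) :=
  if b <= k1 then b / s `^ p else if b <= k2 * s then (b / s) `^ p else 1.

Lemma asgd_gap_boundE d B : (0 < d)%N ->
  asgd_gap_bound a k1 k2 K d B =
  K * asgd_factor (d%:R `^ (1 / 2)) B%:R * d%:R `^ (- (a / 2)).
Proof.
move=> d_gt0; rewrite /asgd_gap_bound /asgd_factor -/p.
set s := d%:R `^ (1 / 2).
have s_gt0 : 0 < s by exact: powR_natr_gt0.
(* On exponents this is [a^2/(2a-1) = p/2 + a/2]. *)
have -> : d%:R `^ (- (a ^+ 2 / (2 * a - 1))) = (s `^ p)^-1 * d%:R `^ (- (a / 2)).
  rewrite -powRrM -powRN -powRD; last by rewrite pnatr_eq0 -lt0n d_gt0 implybT.
  by congr (_ `^ _); rewrite /p; field; rewrite gt_eqF.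
rewrite -mulrA; congr (_ * _); case: ifP => _; first by rewrite mulrA.
case: ifP => _; last by rewrite mul1r.
by rewrite mulrA powR_div// ltW.
Qed.

(** The thresholds [k1] and [k2 * d^(1/2)] come in no fixed order; the last regime starts once both
    are exceeded. *)
Lemma asgd_saturated d B : (0 < d)%N ->
  k1 < B%:R -> k2 * d%:R `^ (1 / 2) < B%:R ->
  asgd_gap_bound a k1 k2 K d B = K * d%:R `^ (- (a / 2)).
Proof.
move=> d_gt0 k1B k2B; rewrite asgd_gap_boundE// /asgd_factor.
by rewrite !leNgt k1B k2B/= mulr1.
Qed.

Lemma asgd_factor_ge (e : R) : 0 < e ->
  exists2 m : R, 0 < m &
    forall s b : R, 0 < s -> 0 < b -> e <= asgd_factor s b -> m * s <= b.
Proof.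
move=> e_gt0.
(* [m1] serves the first regime and [m2] the second; the third gives [k2] directly. The final
   constant is their minimum. *)
pose m1 := (e / k1 `^ (1 - p)) `^ p^-1; pose m2 := e `^ p^-1.
have m1_gt0 : 0 < m1 by rewrite powR_gt0// divr_gt0// powR_gt0.
have m2_gt0 : 0 < m2 by rewrite powR_gt0.
have root (y s b : R) : 0 < y -> 0 < s -> 0 < b ->
    y <= (b / s) `^ p -> y `^ p^-1 * s <= b.
  move=> y_gt0 s_gt0 b_gt0; rewrite -ler_pdivlMr// => yb.
  rewrite -[leRHS]powRr1 ?divr_ge0 ?(ltW b_gt0) ?(ltW s_gt0)// -(divff (lt0r_neq0 p_gt0)) powRrM.
    by apply: ge0_ler_powR; rewrite ?nnegrE ?powR_ge0 ?invr_ge0 ?(ltW p_gt0)// ltW.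
exists (Num.min (Num.min m1 m2) k2); first by rewrite !lt_min m1_gt0 m2_gt0.
move=> s b s_gt0 b_gt0; rewrite /asgd_factor.
have minP m' : Num.min (Num.min m1 m2) k2 <= m' -> m' * s <= b ->
    Num.min (Num.min m1 m2) k2 * s <= b.
  by move=> mm'; apply: le_trans; rewrite ler_pM2r.
case: ifPn => [b_le_k1 eb|_].
  apply: (minP m1); first by rewrite !ge_min lexx.
  apply: root => //; first by rewrite divr_gt0// powR_gt0.
  rewrite ler_pdivrMr ?powR_gt0//; apply: le_trans eb _.
  rewrite powR_div ?(ltW b_gt0) ?(ltW s_gt0)//.
  rewrite mulrAC ler_pM2r ?invr_gt0 ?powR_gt0//.
  (* Split [b = b^p * b^(1-p)]; since [p < 1], the second factor is at most [k1^(1-p)]. *)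
  rewrite -[leLHS]powRr1 ?(ltW b_gt0)// -[X in _ `^ X](subrKC p 1).
  rewrite powRD; last by rewrite (gt_eqF b_gt0) implybT.
  by rewrite ler_pM2l ?powR_gt0//; apply: ge0_ler_powR;
    rewrite ?nnegrE ?subr_ge0// ltW.
case: ifPn => [_ eb|]; last first.
  rewrite -ltNge => /ltW k2b _; apply: minP k2b; by rewrite ge_min lexx orbT.
apply: (minP m2); first by rewrite !ge_min lexx orbT.
exact: root.
Qed.

(** For [s >= 1] one has [1 <= s^p <= s], so in the first regime [k <= b/s <= b/s^p <= k1]. In the
    second, [b/s] lies between [k] and [k2]. The witnesses collect one bound per regime. *)
Lemma asgd_factor_bounded (k : R) : 0 < k ->
  exists m M : R, [/\ 0 < m, 0 < M & forall s b : R, 1 <= s -> k * s <= b ->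
    m <= asgd_factor s b <= M].
Proof.
move=> k_gt0.
exists (Num.min (Num.min k (k `^ p)) 1), (Num.max (Num.max k1 (k2 `^ p)) 1).
split; first by rewrite !lt_min k_gt0 powR_gt0// ltr01.
  by rewrite lt_max ltr01 orbT.
move=> s b s_ge1 ksb; have s_gt0 : 0 < s by exact: lt_le_trans s_ge1.
have b_gt0 : 0 < b by apply: lt_le_trans ksb; rewrite mulr_gt0.
have bs_gt0 : 0 < b / s by exact: divr_gt0.
have sp_gt0 : 0 < s `^ p by rewrite powR_gt0.
have sp_le : s `^ p <= s.
  by rewrite -[leRHS]powRr1 ?(ltW s_gt0)// ler_powR// ltW.
have sp_ge1 : 1 <= s `^ p by rewrite -[leLHS](powRr0 s) ler_powR// ltW.
rewrite /asgd_factor !ge_min !le_max; case: ifPn => [bk1|_].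
  apply/andP; split; apply/orP; left; apply/orP; left.
    by rewrite ler_pdivlMr//; apply: le_trans ksb; rewrite ler_pM2l.
  by rewrite ler_pdivrMr//; apply: le_trans bk1 _; rewrite ler_peMr// ltW.
case: ifPn => [bk2|_]; last by rewrite !lexx !orbT.
apply/andP; split; apply/orP; left; apply/orP; right.
  by apply: (ge0_ler_powR (ltW p_gt0)); rewrite ?nnegrE ?(ltW bs_gt0)//
    ?ler_pdivlMr// ltW.
by apply: (ge0_ler_powR (ltW p_gt0)); rewrite ?nnegrE ?(ltW bs_gt0)//
    ?ler_pdivrMr// ltW.
Qed.

Lemma asgd_batch_ge (c : R) : 0 < c ->
  exists2 m : R, 0 < m & forall d B, (0 < d)%N -> (0 < B)%N ->
    c * d%:R `^ (- (a / 2)) <= asgd_gap_bound a k1 k2 K d B ->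
    m * d%:R `^ (1 / 2) <= B%:R.
Proof.
move=> c_gt0; have [m m_gt0 mP] := @asgd_factor_ge (c / K) (divr_gt0 c_gt0 K_gt0).
exists m => // d B d_gt0 B_gt0.
rewrite asgd_gap_boundE// ler_pM2r ?powR_natr_gt0// => cK.
by apply: mP; rewrite ?powR_natr_gt0 ?ltr0n// ler_pdivrMr// mulrC.
Qed.

Lemma asgd_window_eqsim (k k' : R) : 0 < k ->
  eqsim [set x : nat * nat | batch_window a k k' x.1 x.2]
    (fun x => asgd_gap_bound a k1 k2 K x.1 x.2)
    (fun x => x.1%:R `^ (- (a / 2))).
Proof.
move=> k_gt0; have [m [M [m_gt0 M_gt0 mMP]]] := asgd_factor_bounded _ k_gt0.
exists (K * m), (K * M); split; [exact: mulr_gt0|exact: mulr_gt0|].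
move=> [d B] /= [d_gt0 B_gt0 /andP[kB _]].
rewrite asgd_gap_boundE// !ler_pM2r ?powR_natr_gt0// !ler_pM2l//.
by apply: mMP => //; rewrite powR_natr_ge1.
Qed.

End ASGD.

(** * Critical batch sizes, their ratio, and the saturation window *)

Theorem corollary2 (R : realType) (a : R)
    (H : forall d : nat, 'M[R]_d) (lam : forall d : nat, 'I_d -> R)
    (K_HB K_ASGD k1 k2 c C : R) :
  1 < a ->
  (forall d : nat, pd_spectrum (H d) (lam d)) ->
  power_law a lam ->
  0 < k1 -> 0 < k2 ->
  0 < c -> c <= K_HB <= C -> c <= K_ASGD <= C ->
  let q_HB := hb_gap_bound a K_HB in
  let q_ASGD := asgd_gap_bound a k1 k2 K_ASGD in
  (exists B_HB B_ASGD : nat -> nat,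
    [/\ (forall d, (0 < d)%N ->
           is_critical_batch a c C q_HB d (B_HB d) /\
           is_critical_batch a c C q_ASGD d (B_ASGD d)),
        eqsim [set d : nat | (0 < d)%N]
          (fun d => (B_HB d)%:R) (fun d => d%:R `^ (a / 2)),
        eqsim [set d : nat | (0 < d)%N]
          (fun d => (B_ASGD d)%:R) (fun d => d%:R `^ (1 / 2 : R)),
        eqsim [set d : nat | (0 < d)%N]
          (fun d => (B_HB d)%:R / (B_ASGD d)%:R)
          (fun d => d%:R `^ ((a - 1) / 2))
      & \forall d \near \oo, (B_ASGD d < B_HB d)%N] /\
    (is_gap_upper_bound (@hb_sstar R) lam q_HB ->
     forall d, (0 < d)%N ->
       1 - hb_sstar (B_HB d) (lam d) <= C * d%:R `^ (- (a / 2))) /\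
    (is_gap_upper_bound (@asgd_sstar R) lam q_ASGD ->
     forall d, (0 < d)%N ->
       1 - asgd_sstar (B_ASGD d) (lam d) <= C * d%:R `^ (- (a / 2))))
  /\
  (forall k k' : R, 0 < k -> 0 < k' ->
     eqsim [set p : nat * nat | batch_window a k k' p.1 p.2]
       (fun p => q_ASGD p.1 p.2) (fun p => p.1%:R `^ (- (a / 2))) /\
     (is_gap_upper_bound (@asgd_sstar R) lam q_ASGD ->
      exists M : R, 0 < M /\
        forall d B : nat, batch_window a k k' d B ->
          1 - asgd_sstar B (lam d) <= M * d%:R `^ (- (a / 2)))).
Proof.
move=> a_gt1 _ _ k1_gt0 k2_gt0 c_gt0 /andP[cKh KhC] /andP[cKa KaC] qH qA.
have Kh_gt0 : 0 < K_HB by exact: lt_le_trans cKh.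
have Ka_gt0 : 0 < K_ASGD by exact: lt_le_trans cKa.
have C_gt0 : 0 < C by exact: lt_le_trans KhC.
(* The window clause does not involve the critical batches and is settled first. *)
split; last first.
  move=> k k' k_gt0 _; have qE : eqsim _ _ _ :=
    asgd_window_eqsim a_gt1 k1_gt0 k2_gt0 Ka_gt0 k k' k_gt0.
  split=> // gapP; have [m [M [_ M_gt0 qP]]] := qE.
  exists M; split=> // d B BW; have [d_gt0 B_gt0 _] := BW.
  apply: le_trans (gapP d B d_gt0 B_gt0) _.
  by have /andP[] := qP (d, B) BW.
(* The strict lower inequality is what lets a rounded batch leave the first two ASGD regimes. *)
have natP (y : R) : 0 <= y -> exists2 B : nat, y < B%:R & B%:R <= y + 1.
  move=> y_ge0; have /andP[lb ub] := truncn_itv y_ge0.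
  by exists (Num.truncn y).+1 => //; rewrite -natr1 lerD2r.
(* The witness is [d^(a/2)] rounded up, and [d^(a/2) >= 1] absorbs the rounding into the factor 2.
   At saturation the bound is [K_HB] times the scale, so [c <= K_HB <= C] makes it count as
   reached. *)
have [BH BHP] : exists Bc : nat -> nat, forall d, (0 < d)%N ->
    is_critical_batch a c C qH d (Bc d) /\ (Bc d)%:R <= 2 * d%:R `^ (a / 2).
  apply: exists_critical_batch => d d_gt0.
  have dge1 : 1 <= (d%:R : R) `^ (a / 2).
    by rewrite powR_natr_ge1// divr_ge0// ltW// (lt_trans ltr01).
  have [B ltB Ble] := natP _ (le_trans ler01 dge1); exists B; split.
  - by rewrite -(ltr0n R); apply: lt_trans ltB; exact: lt_le_trans dge1.
  - rewrite /reaches_accelerated /qH hb_saturated ?(ltW ltB)//.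
    by rewrite !ler_pM2r ?powR_natr_gt0// cKh.
  - by apply: le_trans Ble _; rewrite mulr_natl mulr2n lerD2l.
(* Rounding up the sum [k1 + k2 * d^(1/2)] exceeds both thresholds at once; [d^(1/2) >= 1] absorbs
   [k1] and the rounding. *)
have [BA BAP] : exists Bc : nat -> nat, forall d, (0 < d)%N ->
    is_critical_batch a c C qA d (Bc d) /\
    (Bc d)%:R <= (k1 + k2 + 1) * d%:R `^ (1 / 2).
  apply: exists_critical_batch => d d_gt0.
  have dge1 : 1 <= (d%:R : R) `^ (1 / 2) by rewrite powR_natr_ge1.
  have k2d_gt0 : 0 < k2 * d%:R `^ (1 / 2) by rewrite mulr_gt0 ?powR_natr_gt0.
  have [B ltB Ble] := natP _ (ltW (addr_gt0 k1_gt0 k2d_gt0)); exists B; split.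
  - by rewrite -(ltr0n R); apply: lt_trans ltB; exact: addr_gt0.
  - rewrite /reaches_accelerated /qA asgd_saturated//.
    + by rewrite !ler_pM2r ?powR_natr_gt0// cKa.
    + by apply: lt_trans ltB; rewrite ltrDl.
    + by apply: lt_trans ltB; rewrite ltrDr.
  - apply: le_trans Ble _; rewrite !mulrDl [1 * _ `^ _]mul1r.
    by apply: lerD => //; rewrite lerD2r ler_peMr// ltW.
have HE : eqsim [set d : nat | (0 < d)%N]
    (fun d => (BH d)%:R) (fun d => (d%:R : R) `^ (a / 2)).
  exists (c / K_HB), 2; split => [|//|d d_gt0]; first exact: divr_gt0.
  have [[_ /andP[lb _] _] ->] := BHP d d_gt0; rewrite andbT.
  exact: hb_batch_ge lb.
have AE : eqsim [set d : nat | (0 < d)%N]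
    (fun d => (BA d)%:R) (fun d => (d%:R : R) `^ (1 / 2)).
  have [m m_gt0 mP] := asgd_batch_ge a_gt1 k1_gt0 k2_gt0 Ka_gt0 c c_gt0.
  exists m, (k1 + k2 + 1); split=> // [|d d_gt0]; first by rewrite !addr_gt0.
  have [[BA_gt0 /andP[lb _] _] ->] := BAP d d_gt0; rewrite andbT.
  exact: mP lb.
have ratioE : eqsim [set d : nat | (0 < d)%N]
    (fun d => (BH d)%:R / (BA d)%:R) (fun d => (d%:R : R) `^ ((a - 1) / 2)).
  apply: eq_eqsimr (eqsim_div _ _ _ _ _ _ _ _ HE AE) => d d_gt0;
    do ?exact: powR_natr_gt0.
  rewrite -powRN -powRD; first by rewrite mulrBl.
  by rewrite pnatr_eq0 -lt0n d_gt0 implybT.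
exists BH, BA; split; last first.
  split=> gapP d d_gt0.
  - have [[B_gt0 /andP[_ ub] _] _] := BHP d d_gt0.
    exact: le_trans (gapP d _ d_gt0 B_gt0) ub.
  - have [[B_gt0 /andP[_ ub] _] _] := BAP d d_gt0.
    exact: le_trans (gapP d _ d_gt0 B_gt0) ub.
split=> // [d d_gt0|].
  by have [? _] := BHP d d_gt0; have [? _] := BAP d d_gt0.
(* The ratio is at least [m * d^((a-1)/2)] with a positive exponent. It exceeds 1 once
   [d^((a-1)/2) > 1/m], hence for all large [d]. *)
have [m [M [m_gt0 _ mP]]] := ratioE.
have e_gt0 : 0 < (a - 1) / 2 by rewrite divr_gt0// subr_gt0.
near=> d.
have d_gt0 : (0 < d)%N by near: d; exact: nbhs_infty_gt.
have [[BA_gt0 _ _] _] := BAP d d_gt0.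
rewrite -(ltr_nat R) -[ltLHS]mul1r -ltr_pdivlMr ?ltr0n//.
have /andP[lb _] := mP d d_gt0; apply: lt_le_trans lb.
rewrite mulrC -ltr_pdivrMr//; near: d; exact: near_infty_ltr_powR.
Unshelve. all: by end_near. Qed.
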